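(* A PACS-structure of Grassmannian type on a smooth manifold $M$ of dimension $2(p+q)\geq6$ is given by (is equivalent to) an almost Grassmannian structure $TM\cong E^*\otimes F$ of type $(2,p+q)$ on $M$ together with an almost conformally symplectic structure $\ell\subset\Lambda^2T^*M$ which is Hermitian in the Grassmannian sense, i.e. contained in the subbundle $\Lambda^2E\otimes S^2F^*$, and has signature $(p,q)$.
   Context: Almost conformally symplectic structure: a smooth line subbundle $\ell\subset\Lambda^2T^*M$ all of whose non-zero elements are non-degenerate bilinear forms. A first order structure with group $G_0\subset GL(V)$ on $M$ ($\dim M=\dim V$) is a reduction of the structure group of the linear frame bundle to $G_0$. Put $n=p+q\ge3$ and $V=M_{n,2}(\mathbb R)=\mathbb R^{2*}\otimes\mathbb R^n$ (this is $\mathfrak g_{-1}$ in the contact grading of $\mathfrak{so}(p+2,q+2)$). Then $\Lambda^2V^*=(S^2\mathbb R^2\otimes\Lambda^2\mathbb R^{n*})\oplus(\Lambda^2\mathbb R^2\otimes S^2\mathbb R^{n*})$, and one fixes the line in $\Lambda^2V^*$ which is contained in the second summand and is given by $\Lambda^2\mathbb R^2$ tensor an inner product of signature $(p,q)$ on $\mathbb R^n$ (this is the line determined by the Lie bracket $\mathfrak g_{-1}\times\mathfrak g_{-1}\to\mathfrak g_{-2}$). Let $CSp(V)\subset GL(V)$ be the stabilizer of this line and let $G_0$ be the intersection of $CSp(V)$ with the image $H$ of the homomorphism $GL(2,\mathbb R)\times GL(n,\mathbb R)\to GL(V)$ given by multiplying matrices from both sides. A PACS-structure of Grassmannian type is a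 first order structure with structure group $G_0$. An almost Grassmannian structure of type $(2,n)$ on a manifold of dimension $2n$ is a first order structure with structure group $H$; it is described by auxiliary vector bundles $E$ and $F$ of rank $2$ and $n$, together with isomorphisms $TM\cong L(E,F)=E^*\otimes F$ and $\Lambda^2E\cong\Lambda^nF$. It induces $\Lambda^2T^*M\cong(S^2E\otimes\Lambda^2F^* )\oplus(\Lambda^2E\otimes S^2F^* )$. A two-form is Hermitian in the Grassmannian sense if it is a section of $\Lambda^2E\otimes S^2F^*$; since $\Lambda^2E$ is a line bundle, such a form determines at each point a symmetric bilinear form on $F$ up to scale, and in the non-degenerate case its signature $(p,q)$ with $p+q=n$ (well defined up to interchanging $p$ and $q$ according to the sign of the scale) is called the signature of the two-form. *)

(* Defs.v *)
From HB Require Import structures.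
From mathcomp Require Import all_boot all_order all_algebra.
From mathcomp Require Import all_classical all_reals all_analysis.

Set Implicit Arguments.
Unset Strict Implicit.
Unset Printing Implicit Defensive.

Import Order.TTheory GRing.Theory Num.Theory.
Import numFieldNormedType.Exports.

Local Open Scope classical_set_scope.
Local Open Scope ring_scope.

(* Meaningful when [A] is open and [U] is finite dimensional: [f] is C^(k+1) on
   [A] iff it is differentiable there and all its directional derivatives are
   C^k on [A]. *)
Fixpoint Ck (R : realType) (U W : normedModType R) (k : nat) (A : set U)
    (f : U -> W) : Prop :=
  match k with
  | 0%N => forall x, A x -> {for x, continuous f}
  | j.+1 => (forall x, A x -> differentiable f x) /\
            (forall v, Ck j A (fun x => 'D_v f x))
  end.

Definition smooth_on (R : realType) (U W : normedModType R) (A : set U)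
    (f : U -> W) : Prop :=
  forall k, Ck k A f.

(* [cinv] is total; only its values on the open set [cmap @` cdom] matter. *)
Record chart (R : realType) (M : topologicalType) (m : nat) := Chart {
  cdom : set M ;
  cmap : M -> 'rV[R]_m ;
  cinv : 'rV[R]_m -> M ;
  chart_open_dom : open cdom ;
  chart_open_img : open (cmap @` cdom) ;
  chartK : forall x, cdom x -> cinv (cmap x) = x ;
  chart_continuous : forall x, cdom x -> {for x, continuous cmap} ;
  chart_inv_continuous :
    forall z, (cmap @` cdom) z -> {for z, continuous cinv}
}.

(* The atlas need not be maximal.  It comes with a choice of a preferred chart
   around each point, used to realize the tangent spaces. *)
Record manifold (R : realType) (m : nat) := Manifold {
  points :> topologicalType ;
  points_hausdorff : hausdorff_space points ;
  points_second_countable : @second_countable points ;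
  atlas : set (chart R points m) ;
  chart_at : points -> chart R points m ;
  chart_at_atlas : forall x, atlas (chart_at x) ;
  chart_at_dom : forall x, cdom (chart_at x) x ;
  transition_smooth : forall c c', atlas c -> atlas c' ->
    smooth_on (cmap c @` (cdom c `&` cdom c')) (cmap c' \o cinv c)
}.

(* A tangent vector at [x] is given by its components in the preferred chart
   [chart_at x]; [tan_to] and [tan_from] convert to and from its components in
   another chart [c] around [x] by differentiating the coordinate change. *)
Definition tangent (R : realType) (m : nat) (M : manifold R m) (x : M) :
  normedModType R := 'rV[R]_m.

Definition tan_to (R : realType) (m : nat) (M : manifold R m)
    (c : chart R M m) (x : M) (v : tangent x) : 'rV[R]_m :=
  'd (cmap c \o cinv (chart_at x)) (cmap (chart_at x) x) v.

Definition tan_from (R : realType) (m : nat) (M : manifold R m)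
    (c : chart R M m) (x : M) (a : 'rV[R]_m) : tangent x :=
  'd (cmap (chart_at x) \o cinv c) (cmap c x) a.

Definition smooth_vector_field (R : realType) (m : nat) (M : manifold R m)
    (U : set M) (X : forall x : M, tangent x) : Prop :=
  forall c, atlas c ->
    smooth_on (cmap c @` (U `&` cdom c))
      (fun z => tan_to c (X (cinv c z))).

Definition form2 (R : realType) (V : lmodType R) := V -> V -> R.

Definition zero_form (R : realType) (V : lmodType R) : form2 V :=
  fun _ _ => 0.

Definition alternating (R : realType) (V : lmodType R) (w : form2 V) : Prop :=
  [/\ forall v, scalar (w v), forall v, scalar (w^~ v) & forall v, w v v = 0].

Definition nondegenerate (R : realType) (V : lmodType R) (w : form2 V) : Prop :=
  forall v, (forall v', w v v' = 0) -> v = 0.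

Definition pullback (R : realType) (V W : lmodType R) (u : V -> W)
    (w : form2 W) : form2 V :=
  fun v v' => w (u v) (u v').

Definition form_line (R : realType) (V : lmodType R) (w : form2 V) :
    set (form2 V) :=
  [set w' | exists a : R, w' = fun v v' => a * w v v'].

(* [a] and [b] range over constant coordinate fields of the chart [c]. *)
Definition smooth_form2 (R : realType) (m : nat) (M : manifold R m)
    (U : set M) (w : forall x : M, form2 (tangent x)) : Prop :=
  forall c, atlas c -> forall a b : 'rV[R]_m,
    smooth_on (cmap c @` (U `&` cdom c))
      (fun z => w (cinv c z) (tan_from c (cinv c z) a)
                             (tan_from c (cinv c z) b)).

Definition smooth_line_subbundle (R : realType) (m : nat) (M : manifold R m)
    (l : forall x : M, set (form2 (tangent x))) : Prop :=
  forall x : M, exists U : set M, exists w : forall y : M, form2 (tangent y),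
    [/\ open U, U x, smooth_form2 U w &
        forall y, U y ->
          [/\ alternating (w y), w y <> @zero_form R _ &
              l y = form_line (w y)]].

Definition almost_conformally_symplectic (R : realType) (m : nat)
    (M : manifold R m) (l : forall x : M, set (form2 (tangent x))) : Prop :=
  smooth_line_subbundle l /\
  (forall (x : M) w, l x w -> w <> @zero_form R _ -> nondegenerate w).

Definition GL (R : realType) (V : lmodType R) : set (V -> V) :=
  [set g | linear g /\ bijective g].

(* Reductions of the linear frame bundle, whose fiber at [x] consists of the
   linear isomorphisms [V -> T_x M], to the subgroup [G] of [GL V]: subsets of
   the frame bundle whose fibers are single [G]-orbits and which admit smooth
   local sections.  A local frame [s] is smooth iff all the vector fields
   [y |-> s y v] are. *)
Definition first_order_structure (R : realType) (V : lmodType R)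
    (G : set (V -> V)) (m : nat) (M : manifold R m)
    (P : forall x : M, set (V -> tangent x)) : Prop :=
  [/\ forall (x : M) u, P x u -> linear u /\ bijective u,
      forall (x : M) u, P x u -> P x = [set u \o g | g in G] &
      forall x : M, exists U : set M, exists s : forall y : M, V -> tangent y,
        [/\ open U, U x, forall y, U y -> P y (s y) &
            forall v, smooth_vector_field U (fun y => s y v)]].

(* [B] has signature [(p, q)] if it has an orthogonal basis (the rows of [S])
   with [p] vectors of positive and [q] vectors of negative square. *)
Definition signature (R : realType) (n : nat) (B : 'M[R]_n) (p q : nat) :
    Prop :=
  exists S : 'M[R]_n, exists d : 'rV[R]_n,
    [/\ S \in unitmx, S *m B *m S^T = diag_mx d,
        #|[set i | 0 < d 0 i]%SET| = p & #|[set i | d 0 i < 0]%SET| = q].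

(* [V = R^2* (x) R^n] is the space of n x 2 matrices.  This is the tensor of the
   standard generator of [Lambda^2 R^2] with the bilinear form [b] of matrix [B]:
   with [X_0, X_1] the columns of [X], it maps [(X, Y)] to
   [b(X_0, Y_1) - b(X_1, Y_0)]. *)
Definition vol_tensor (R : realType) (n : nat) (B : 'M[R]_n) :
    form2 'M[R]_(n, 2) :=
  fun X Y => (X^T *m B *m Y) 0 1 - (X^T *m B *m Y) 1 0.

(* The summand [Lambda^2 R^2 (x) S^2 R^n*] of [Lambda^2 V^*]. *)
Definition hermitian_model (R : realType) (n : nat) :
    set (form2 'M[R]_(n, 2)) :=
  [set w | exists2 B : 'M[R]_n, B^T = B & w = vol_tensor B].

(* The image of [GL(2, R) x GL(n, R)] in [GL V]. *)
Definition grassmannian_group (R : realType) (n : nat) :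
    set ('M[R]_(n, 2) -> 'M[R]_(n, 2)) :=
  [set h | exists A : 'M[R]_2, exists B : 'M[R]_n,
    [/\ A \in unitmx, B \in unitmx & h = fun X => B *m X *m invmx A]].

(* [g] is the matrix of the fixed inner product on [R^n]. *)
Definition CSp (R : realType) (n : nat) (g : 'M[R]_n) :
    set ('M[R]_(n, 2) -> 'M[R]_(n, 2)) :=
  [set f | GL f /\
    [set pullback f w | w in form_line (vol_tensor g)]
      = form_line (vol_tensor g)].

Definition PACS_structure (R : realType) (n : nat) (g : 'M[R]_n) (m : nat)
    (M : manifold R m) (P : forall x : M, set ('M[R]_(n, 2) -> tangent x)) :
    Prop :=
  first_order_structure (CSp g `&` @grassmannian_group R n) P.

Definition almost_grassmannian (R : realType) (n : nat) (m : nat)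
    (M : manifold R m) (Q : forall x : M, set ('M[R]_(n, 2) -> tangent x)) :
    Prop :=
  first_order_structure (@grassmannian_group R n) Q.

(* A frame [u] in [Q x] identifies [T_x M] with [E_x^* (x) F_x] for [E_x = R^2]
   and [F_x = R^n]; it is unique up to changes of basis in [E_x] and [F_x], which
   preserve [hermitian_model].  So this is the fiber at [x] of the subbundle
   [Lambda^2 E (x) S^2 F^*] of [Lambda^2 T^*M]. *)
Definition hermitian_forms (R : realType) (n m : nat) (M : manifold R m)
    (Q : forall x : M, set ('M[R]_(n, 2) -> tangent x)) (x : M) :
    set (form2 (tangent x)) :=
  [set w | exists2 u, Q x u & @hermitian_model R n (pullback u w)].
Arguments hermitian_forms {R n m M} Q x _.

Definition hermitian_line (R : realType) (n m : nat) (M : manifold R m)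
    (Q : forall x : M, set ('M[R]_(n, 2) -> tangent x))
    (l : forall x : M, set (form2 (tangent x))) : Prop :=
  forall x : M, l x `<=` hermitian_forms Q x.

(* The symmetric form [B] on [F_x = R^n] determined by an element of [l x] is
   defined up to scale only, so its signature up to exchanging [p] and [q]. *)
Definition line_signature (R : realType) (n m : nat) (M : manifold R m)
    (Q : forall x : M, set ('M[R]_(n, 2) -> tangent x))
    (l : forall x : M, set (form2 (tangent x))) (p q : nat) : Prop :=
  forall (x : M) (w : form2 (tangent x)) u,
    l x w -> w <> @zero_form R (tangent x) -> Q x u ->
    exists2 B : 'M[R]_n, B^T = B /\ pullback u w = vol_tensor B &
      signature B p q \/ signature B q p.

(* Extension of the structure group to [grassmannian_group]. *)
Definition induced_grassmannian (R : realType) (n m : nat) (M : manifold R m)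
    (P : forall x : M, set ('M[R]_(n, 2) -> tangent x)) :
    forall x : M, set ('M[R]_(n, 2) -> tangent x) :=
  fun x => [set u \o h | u in P x & h in @grassmannian_group R n].

Definition induced_line (R : realType) (n : nat) (g : 'M[R]_n) (m : nat)
    (M : manifold R m) (P : forall x : M, set ('M[R]_(n, 2) -> tangent x)) :
    forall x : M, set (form2 (tangent x)) :=
  fun x =>
    [set w | exists2 u, P x u & form_line (vol_tensor g) (pullback u w)].

(* Main.v *)
Require Import Defs.
From HB Require Import structures.
From mathcomp Require Import all_boot all_order all_algebra.
From mathcomp Require Import all_classical all_reals all_analysis.
From mathcomp Require Import perm ring.

Set Implicit Arguments.
Unset Strict Implicit.
Unset Printing Implicit Defensive.

Import Order.TTheory GRing.Theory Num.Theory.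
Import numFieldNormedType.Exports.

Local Open Scope classical_set_scope.
Local Open Scope ring_scope.

(** Everything happens in one tangent space at a time, except for the existence of
    local sections.

    Given a structure [P] with group [G_0], extending the group gives [Q], and [l] is
    the line which every frame of [P] identifies with the model line.  It is well
    defined since [G_0] preserves the model line ([induced_lineE]), it is spanned
    locally by the model form transported by a smooth frame ([smooth_frame_form]), and
    in an arbitrary frame of [Q] its elements are model forms with [g] replaced by a
    multiple of a congruent matrix ([vol_tensor_mul]).  This gives the Hermitian
    property and the signature, a negative multiple exchanging [p] and [q], while
    nondegeneracy is that of the model form.

    Conversely, send a pair [(Q, l)] to the set [adapted_frames Q l] of those frames
    in [Q] that carry some element of [l] to the model form.  By definition [G_0]
    consists of the elements of the Grassmannian group preserving the model line.
    So two adapted frames at a point differ exactly by an element of [G_0]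
    ([adapted_frames_pacs]), and the adapted frames of the pair induced by [P]
    are those of [P] ([adapted_frames_induced]).  Hence the two constructions are
    inverse to each other as soon as adapted frames exist.

    The heart of the matter is that they exist locally and smoothly
    ([adapted_frames_section]).  A frame of [Q] turns a local generator of [l] into a
    smooth family of symmetric matrices of constant signature, and one has to bring
    this family to the form [g] by a smooth family of congruences.  At a single point
    this is Sylvester's theorem ([signature_congruent]); near the point it is done
    by completing squares, which only uses field operations and square roots
    of positive functions ([smooth_sylvester]). *)

(** * Calculus of smooth functions on open sets *)

(** The differential is characterized by a first order expansion, which only
    sees the germ of the function. *)
Lemma near_eq_differentiable (R : realType) (V W : normedModType R)
    (f g : V -> W) (x : V) :
  (\near x, f x = g x) -> differentiable f x ->
  differentiable g x /\ 'd g x = 'd f x :> (V -> W).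
Proof.
move=> fg df.
have fgx : f x = g x by exact: nbhs_singleton fg.
have gE : g \o shift x = cst (g x) + 'd f x +o_ 0 id.
  apply/eqaddoP => e e0.
  move/diff_locally : df => /eqaddoP/(_ _ e0).
  have fg0 : \forall h \near (0 : V), f (h + x) = g (h + x).
    by move: fg; rewrite (near_shift 0) /= subr0.
  apply: filterS2 fg0 => h.
  by rewrite !fctE /= => <-; rewrite fgx.
have dgE : 'd g x = 'd f x :> (V -> W).
  by apply: diff_unique gE; exact: diff_continuous.
split=> //; apply/diff_locallyP; rewrite dgE; split=> //.
exact: diff_continuous.
Qed.

Lemma open_near (T : topologicalType) (A : set T) (P : T -> Prop) x :
  open A -> (forall y, A y -> P y) -> A x -> \near x, P x.
Proof.
move=> oA AP Ax; apply: filterS (open_nbhs_nbhs _); first exact: AP.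
by split.
Qed.

Section Ck.
Variables (R : realType) (V : normedModType R) (A : set V).
Hypothesis oA : open A.

(** Openness of [A] makes the derivatives at points of [A] depend on the values
    on [A] alone; all rules below compute a derivative on [A] and then use this. *)
Lemma Ck_congr (W : normedModType R) k (f g : V -> W) :
  (forall x, A x -> f x = g x) -> Ck k A f -> Ck k A g.
Proof.
elim: k f g => [|k IH] f g fg.
  move=> cf x Ax; have gx : g x' @[x' --> x] --> f x.
    by apply: cvg_trans (cf _ Ax); apply: near_eq_cvg; exact: open_near oA _ Ax.
  by rewrite fg in gx.
move=> [df Df]; split=> [x Ax|v].
  exact: (near_eq_differentiable (open_near oA fg Ax) (df _ Ax)).1.
apply: IH (Df v) => x Ax; apply: near_eq_derive; exact: open_near oA _ Ax.
Qed.

Lemma Ck_S (W : normedModType R) k (f : V -> W) : Ck k.+1 A f -> Ck k A f.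
Proof.
elim: k f => [|k IH] f [df Df].
  by move=> x Ax; apply: differentiable_continuous; exact: df.
by split=> // v; apply: IH; exact: Df.
Qed.

Lemma Ck_cst (W : normedModType R) k (a : W) : Ck k A (fun=> a).
Proof.
elim: k a => [|k IH] a; first by move=> x _; exact: cst_continuous.
split=> [x _|v]; first exact: differentiable_cst.
by apply: Ck_congr (IH 0) => x Ax; rewrite derive_cst.
Qed.

Lemma CkD (W : normedModType R) k (f g : V -> W) :
  Ck k A f -> Ck k A g -> Ck k A (fun x => f x + g x).
Proof.
elim: k f g => [|k IH] f g.
  by move=> cf cg x Ax; apply: cvgD; [exact: cf|exact: cg].
move=> [df Df] [dg Dg]; split=> [x Ax|v].
  by apply: differentiableD; [exact: df|exact: dg].
apply: Ck_congr (IH _ _ (Df v) (Dg v)) => x Ax.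
by rewrite -deriveD//; apply: diff_derivable; [exact: df|exact: dg].
Qed.

Lemma CkZl (W : normedModType R) k (f : V -> R) (a : W) :
  Ck k A f -> Ck k A (fun x => f x *: a).
Proof.
elim: k f => [|k IH] f.
  by move=> cf x Ax; apply: cvgZr_tmp; exact: cf.
move=> [df Df]; split=> [x Ax|v].
  by apply: differentiableZl; exact: df.
apply: Ck_congr (IH _ (Df v)) => x Ax.
rewrite (deriveE _ (df _ Ax)) deriveE ?diffZl//; first exact: df.
by apply: differentiableZl; exact: df.
Qed.

Lemma CkM k (f g : V -> R) :
  Ck k A f -> Ck k A g -> Ck k A (fun x => f x * g x).
Proof.
elim: k f g => [|k IH] f g.
  by move=> cf cg x Ax; apply: cvgM; [exact: cf|exact: cg].
move=> fC gC; have [df Df] := fC; have [dg Dg] := gC; split=> [x Ax|v].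
  by apply: differentiableM; [exact: df|exact: dg].
have := CkD (IH _ _ (Ck_S fC) (Dg v)) (IH _ _ (Ck_S gC) (Df v)).
apply: Ck_congr => x Ax.
rewrite -[RHS]/('D_v (f * g) x) deriveM//.
  by apply: diff_derivable; exact: df.
by apply: diff_derivable; exact: dg.
Qed.

Lemma CkV k (f : V -> R) : (forall x, A x -> f x != 0) ->
  Ck k A f -> Ck k A (fun x => (f x)^-1).
Proof.
move=> f0; elim: k => [|k IH].
  by move=> cf x Ax; apply: cvgV; [exact: f0|exact: cf].
move=> fC; have [df Df] := fC; split=> [x Ax|v].
  by apply: differentiableV; [exact: df|exact: f0].
have fV := IH (Ck_S fC).
have := CkM (CkM (@Ck_cst R k (-1)) (CkM fV fV)) (Df v).
apply: Ck_congr => x Ax.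
rewrite deriveV ?f0//; last by apply: diff_derivable; exact: df.
by rewrite mulN1r -invfM -expr2.
Qed.

(** The derivative [f' / (2 sqrt f)] is built from [f'] and from [sqrt f] itself
    at one order less, so that induction on the order applies. *)
Lemma Ck_sqrt k (f : V -> R) : (forall x, A x -> 0 < f x) ->
  Ck k A f -> Ck k A (fun x => Num.sqrt (f x)).
Proof.
move=> f0; elim: k => [|k IH].
  move=> cf x Ax; apply: continuous_comp; first exact: cf.
  exact: sqrt_continuous.
move=> fC; have [df Df] := fC.
have dsqrt x : A x -> differentiable (Num.sqrt : R -> R) (f x).
  move=> Ax; apply/derivable1_diffP.
  exact: (@ex_derive _ _ _ _ _ _ _ (is_derive1_sqrt (f0 _ Ax))).
split=> [x Ax|v].
  by apply: differentiable_comp; [exact: df|exact: dsqrt].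
have sV : Ck k A (fun x => (2 * Num.sqrt (f x))^-1).
  apply: CkV; last by apply: CkM; [exact: Ck_cst|exact: IH (Ck_S fC)].
  by move=> x Ax; rewrite mulf_neq0 ?pnatr_eq0// gt_eqF// sqrtr_gt0 f0.
have := CkM (Df v) sV.
apply: Ck_congr => x Ax.
rewrite [RHS]deriveE; last by apply: differentiable_comp; [exact: df|exact: dsqrt].
rewrite (diff_comp (df _ Ax) (dsqrt _ Ax)) /= (diff1E (dsqrt _ Ax)).
by rewrite derive1E (derive_sqrt (f0 _ Ax)) (deriveE _ (df _ Ax)).
Qed.

Lemma Ck_coord m n k (f : V -> 'M[R]_(m, n)) i j :
  Ck k A f -> Ck k A (fun x => f x i j).
Proof.
elim: k f => [|k IH] f.
  move=> cf x Ax; apply: (@continuous_comp _ _ _ f (fun M : 'M[R]_(m, n) => M i j)).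
    exact: cf.
  exact: coord_continuous.
move=> [df Df]; split=> [x Ax|v].
  apply: (@differentiable_comp _ _ _ _ f (fun M : 'M[R]_(m, n) => M i j)).
    exact: df.
  exact: differentiable_coord.
apply: Ck_congr (IH _ (Df v)) => x Ax.
by rewrite derive_mx ?mxE//; apply: diff_derivable; exact: df.
Qed.

Lemma smooth_congr (W : normedModType R) (f g : V -> W) :
  (forall x, A x -> f x = g x) -> smooth_on A f -> smooth_on A g.
Proof. by move=> fg sf k; exact: Ck_congr fg (sf k). Qed.

Lemma smooth_cst (W : normedModType R) (a : W) : smooth_on A (fun=> a).
Proof. by move=> k; exact: Ck_cst. Qed.

Lemma smoothD (W : normedModType R) (f g : V -> W) :
  smooth_on A f -> smooth_on A g -> smooth_on A (fun x => f x + g x).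
Proof. by move=> sf sg k; exact: CkD. Qed.

Lemma smoothZl (W : normedModType R) (f : V -> R) (a : W) :
  smooth_on A f -> smooth_on A (fun x => f x *: a).
Proof. by move=> sf k; exact: CkZl. Qed.

Lemma smoothM (f g : V -> R) :
  smooth_on A f -> smooth_on A g -> smooth_on A (fun x => f x * g x).
Proof. by move=> sf sg k; exact: CkM. Qed.

Lemma smoothV (f : V -> R) : (forall x, A x -> f x != 0) ->
  smooth_on A f -> smooth_on A (fun x => (f x)^-1).
Proof. by move=> f0 sf k; exact: CkV. Qed.

Lemma smooth_sqrt (f : V -> R) : (forall x, A x -> 0 < f x) ->
  smooth_on A f -> smooth_on A (fun x => Num.sqrt (f x)).
Proof. by move=> f0 sf k; exact: Ck_sqrt. Qed.

Lemma smooth_coord m n (f : V -> 'M[R]_(m, n)) i j :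
  smooth_on A f -> smooth_on A (fun x => f x i j).
Proof. by move=> sf k; exact: Ck_coord. Qed.

Lemma smooth_sum (W : normedModType R) (I : Type) (r : seq I) (P : pred I)
    (f : I -> V -> W) :
  (forall i, P i -> smooth_on A (f i)) ->
  smooth_on A (fun x => \sum_(i <- r | P i) f i x).
Proof.
move=> sf; elim: r => [|i r IH].
  by apply: smooth_congr (smooth_cst 0) => x _; rewrite big_nil.
have [Pi|nPi] := boolP (P i).
  by apply: smooth_congr (smoothD (sf _ Pi) IH) => x _; rewrite big_cons Pi.
by apply: smooth_congr IH => x _; rewrite big_cons (negbTE nPi).
Qed.

Lemma smooth_prod (I : Type) (r : seq I) (f : I -> V -> R) :
  (forall i, smooth_on A (f i)) ->
  smooth_on A (fun x => \prod_(i <- r) f i x).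
Proof.
move=> sf; elim: r => [|i r IH].
  by apply: smooth_congr (@smooth_cst R 1) => x _; rewrite big_nil.
by apply: smooth_congr (smoothM (sf _) IH) => x _; rewrite big_cons.
Qed.

Lemma smooth_row n (f : V -> 'rV[R]_n) :
  (forall i, smooth_on A (fun x => f x 0 i)) -> smooth_on A f.
Proof.
move=> sf; apply: (@smooth_congr _ (fun x => \sum_i f x 0 i *: delta_mx 0 i)).
  by move=> x _; rewrite -row_sum_delta.
by apply: smooth_sum => i _; exact: smoothZl.
Qed.

Lemma smooth_det n (f : V -> 'M[R]_n) :
  (forall i j, smooth_on A (fun x => f x i j)) ->
  smooth_on A (fun x => \det (f x)).
Proof.
move=> sf; apply: smooth_sum => s _; apply: smoothM; first exact: smooth_cst.
by apply: smooth_prod => i; exact: sf.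
Qed.

(** By Cramer's rule the entries of the inverse are polynomials in the entries,
    divided by the determinant. *)
Lemma smooth_invmx n (f : V -> 'M[R]_n) :
  (forall x, A x -> f x \in unitmx) ->
  (forall i j, smooth_on A (fun x => f x i j)) ->
  forall i j, smooth_on A (fun x => invmx (f x) i j).
Proof.
move=> fU sf i j.
have sdet := smooth_det sf.
have sadj : smooth_on A (fun x => \adj (f x) i j).
  apply: (@smooth_congr R (fun x => (-1) ^+ (j + i) *
    \det (\matrix_(a, b) f x (lift j a) (lift i b)))).
    move=> x _; rewrite mxE /cofactor; congr (_ * \det _).
    by apply/matrixP => a b; rewrite !mxE.
  apply: smoothM; first exact: smooth_cst.
  apply: smooth_det => a b.
  by apply: smooth_congr (sf (lift j a) (lift i b)) => x _; rewrite mxE.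
have dV : forall x, A x -> \det (f x) != 0.
  by move=> x /fU; rewrite unitmxE unitfE.
apply: smooth_congr (smoothM (smoothV dV sdet) sadj) => x Ax.
by rewrite /invmx fU// [RHS]mxE.
Qed.

End Ck.

Lemma smooth_subset (R : realType) (V W : normedModType R) (A B : set V)
    (f : V -> W) : B `<=` A -> smooth_on A f -> smooth_on B f.
Proof.
move=> BA sf k; move: (sf k); elim: k f {sf} => [|k IH] f.
  by move=> cf x /BA; exact: cf.
by move=> [df Df]; split=> [x /BA|v]; [exact: df|exact: (IH _ (Df v))].
Qed.

(** * Hermitian forms on the model space and signatures *)

Section VolTensor.
Variables (R : realType) (n : nat).
Implicit Types (B C : 'M[R]_n) (X Y : 'M[R]_(n, 2)).

Lemma vol_tensorZ a B X Y : vol_tensor (a *: B) X Y = a * vol_tensor B X Y.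
Proof. by rewrite /vol_tensor -scalemxAr -scalemxAl !mxE -mulrBr. Qed.

Lemma vol_tensor_linearl B Y : scalar ((vol_tensor B)^~ Y).
Proof.
move=> a X X'; rewrite /vol_tensor linearD linearZ /= !mulmxDl -!scalemxAl.
by move: (_ *m Y) (_ *m Y) => P Q; rewrite !mxE; ring.
Qed.

Lemma vol_tensor_linearr B X : scalar (vol_tensor B X).
Proof.
move=> a Y Y'; rewrite /vol_tensor mulmxDr -scalemxAr.
by move: (_ *m Y) (_ *m Y') => P Q; rewrite !mxE; ring.
Qed.

Lemma vol_tensor_alt B X : B^T = B -> vol_tensor B X X = 0.
Proof.
move=> symB; have : (X^T *m B *m X)^T = X^T *m B *m X.
  by rewrite !trmx_mul symB trmxK mulmxA.
by rewrite /vol_tensor => XBX; rewrite -[in X in X - _]XBX mxE subrr.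
Qed.

Lemma alternating_vol B : B^T = B -> Defs.alternating (vol_tensor B).
Proof.
move=> symB; split=> [X|Y|X].
- exact: vol_tensor_linearr.
- exact: vol_tensor_linearl.
- exact: vol_tensor_alt.
Qed.

Lemma mulmx_delta m k (A : 'M[R]_(m, n)) (j : 'I_n) (l : 'I_k) i l' :
  (A *m delta_mx j l) i l' = A i j *+ (l' == l).
Proof.
rewrite mxE (bigD1 j)//= mxE eqxx /= big1 ?addr0 => [|h hj].
  by rewrite mulr_natr.
by rewrite mxE (negbTE hj) mulr0.
Qed.

Lemma vol_tensor_delta1 B X j : vol_tensor B X (delta_mx j 1) = (X^T *m B) 0 j.
Proof. by rewrite /vol_tensor !mulmx_delta /= mulr1n mulr0n subr0. Qed.

Lemma vol_tensor_delta0 B X j : vol_tensor B X (delta_mx j 0) = - (X^T *m B) 1 j.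
Proof. by rewrite /vol_tensor !mulmx_delta /= mulr1n mulr0n sub0r. Qed.

(** How the symmetric matrix is recovered from the two-form: this is what makes
    it depend smoothly on the form. *)
Lemma vol_tensor_entry B i j : vol_tensor B (delta_mx i 0) (delta_mx j 1) = B i j.
Proof. rewrite vol_tensor_delta1 trmx_delta mxE (bigD1 i)//= mxE !eqxx mul1r.
by rewrite big1 ?addr0// => h hi; rewrite mxE (negbTE hi) mul0r. Qed.

(** Testing [X] against the elementary matrices of the second (resp. first)
    column reads off the entries of the first (resp. second) row of [X^T *m B]. *)
Lemma nondegenerate_vol B : B \in unitmx -> Defs.nondegenerate (vol_tensor B).
Proof.
move=> uB X X0; apply: trmx_inj; rewrite trmx0 -[X^T](mulmxK uB).
suff -> : X^T *m B = 0 by rewrite mul0mx.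
apply/matrixP => i j; rewrite [RHS]mxE.
have [->|->] : i = 0 \/ i = 1.
  by case: i => -[|[|//]] ?; [left|right]; exact: val_inj.
- by rewrite -vol_tensor_delta1 X0.
- by apply/eqP; rewrite -oppr_eq0 -vol_tensor_delta0 X0.
Qed.

(** [GL(2)] acts on the line [Lambda^2 R^2] by the determinant, hence the
    Grassmannian group preserves the Hermitian forms and acts on the symmetric
    matrix by congruence up to scale. *)
Lemma vol_tensor_mul B (K : 'M[R]_n) (A : 'M[R]_2) X Y :
  vol_tensor B (K *m X *m A) (K *m Y *m A) =
  vol_tensor (\det A *: (K^T *m B *m K)) X Y.
Proof.
rewrite vol_tensorZ /vol_tensor !trmx_mul !mulmxA.
have detA (N : 'M[R]_2) :
  (A^T *m N *m A) 0 1 - (A^T *m N *m A) 1 0 = \det A * (N 0 1 - N 1 0).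
  rewrite (expand_det_row _ 0) !mxE !big_ord_recl !big_ord0 /cofactor !det_mx11.
  rewrite !mxE !big_ord_recl !big_ord0 !mxE /=.
  have -> : lift 0 0 = 1 :> 'I_2 by exact: val_inj.
  have -> : lift 1 0 = 0 :> 'I_2 by exact: val_inj.
  have -> : ord0 = 0 :> 'I_2 by [].
  rewrite expr0 expr1; ring.
by have := detA (X^T *m K^T *m B *m K *m Y); rewrite !mulmxA.
Qed.

End VolTensor.

Section Signature.
Variables (R : realType) (n : nat).
Implicit Types (B g K : 'M[R]_n) (d : 'rV[R]_n).

Lemma signature_neq0 p q d : (p + q = n)%N ->
  #|[set i | 0 < d 0 i]%SET| = p -> #|[set i | d 0 i < 0]%SET| = q ->
  forall i, d 0 i != 0.
Proof.
move=> pq dp dq i.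
have : ([set i | 0 < d 0 i] :|: [set i | d 0 i < 0])%SET = [set: 'I_n]%SET.
  apply/eqP; rewrite eqEcard finset.subsetT /= cardsT card_ord cardsU dp dq.
  suff -> : ([set i | 0 < d 0 i] :&: [set i | d 0 i < 0])%SET = finset.set0.
    by rewrite cards0 subn0 pq.
  apply/setP => j; rewrite !inE; apply/negP => /andP[/lt_trans h /h].
  by rewrite ltxx.
by move=> /setP/(_ i); rewrite !inE neq_lt orbC.
Qed.

Lemma diag_unitmx d : (forall i, d 0 i != 0) -> diag_mx d \in unitmx.
Proof.
by move=> d0; rewrite unitmxE det_diag unitfE; apply/prodf_neq0 => i _.
Qed.

Lemma signature_unitmx B p q : (p + q = n)%N -> signature B p q -> B \in unitmx.
Proof.
move=> pq [S [d [uS Sd dp dq]]].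
have := diag_unitmx (signature_neq0 pq dp dq).
by rewrite -Sd !unitmx_mul => /andP[/andP[]].
Qed.

Lemma signature_congr B K p q : K \in unitmx ->
  signature B p q -> signature (K^T *m B *m K) p q.
Proof.
move=> uK [S [d [uS Sd dp dq]]]; exists (S *m invmx K^T), d.
have uKT : K^T \in unitmx by rewrite unitmx_tr.
split=> //; first by rewrite unitmx_mul uS unitmx_inv.
rewrite trmx_mul trmx_inv trmxK -Sd !mulmxA mulmxKV//.
by rewrite -(mulmxA _ K) mulmxV// mulmx1.
Qed.

Lemma signature_scale_gt0 B c p q : 0 < c ->
  signature B p q -> signature (c *: B) p q.
Proof.
move=> c0 [S [d [uS Sd dp dq]]]; exists S, (c *: d).
split=> //; first by rewrite -scalemxAr -scalemxAl Sd linearZ.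
- by rewrite -[RHS]dp; apply: eq_card => i; rewrite !inE mxE pmulr_rgt0.
- by rewrite -[RHS]dq; apply: eq_card => i; rewrite !inE mxE pmulr_rlt0.
Qed.

Lemma signature_scale_lt0 B c p q : c < 0 ->
  signature B p q -> signature (c *: B) q p.
Proof.
move=> c0 [S [d [uS Sd dp dq]]]; exists S, (c *: d).
split=> //; first by rewrite -scalemxAr -scalemxAl Sd linearZ.
- by rewrite -[RHS]dq; apply: eq_card => i; rewrite !inE mxE nmulr_rgt0.
- by rewrite -[RHS]dp; apply: eq_card => i; rewrite !inE mxE nmulr_rlt0.
Qed.

(** The indicator families of [a] and [b] are equal up to reordering. *)
Lemma perm_of_card (a b : {set 'I_n}) :
  #|a| = #|b| -> exists s : {perm 'I_n}, forall i, (i \in a) = (s i \in b).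
Proof.
move=> ab; pose t (e : {set 'I_n}) := [tuple i \in e | i < n].
have count_t (e : {set 'I_n}) : count_mem true (t e) = #|e|.
  rewrite /= count_map -sum1_count -sum1_card big_enum_cond /=.
  by apply: eq_bigl => i; rewrite /= eqb_id.
have perm_t : perm_eq (t a) (t b).
  have count_f (e : {set 'I_n}) : count_mem false (t e) = (n - #|e|)%N.
    have := count_predC (pred1 true) (t e); rewrite size_tuple count_t.
    have -> : count (predC (pred1 true)) (t e) = count_mem false (t e).
      by apply: eq_count => -[].
    by move=> /(congr1 (subn^~ #|e|)) <-; rewrite addKn.
  by apply/allP => -[] _; rewrite /= ?count_t ?count_f ab.
have /tuple_permP[s /val_inj ts] := perm_t.
exists s => i; have := congr1 (fun u => tnth u i) ts.
by rewrite !tnth_mktuple.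
Qed.

(** The easy half of Sylvester's law: two diagonal matrices with the same numbers
    of positive and of negative entries differ by a permutation of the basis and
    a rescaling of each basis vector by a square root. *)
Lemma signature_congruent B g p q : (p + q = n)%N ->
  signature B p q -> signature g p q ->
  exists2 K, K \in unitmx & K^T *m B *m K = g.
Proof.
move=> pq [S [d [uS Sd dp dq]]] [T [e [uT Te ep eq]]].
have d0 := signature_neq0 pq dp dq; have e0 := signature_neq0 pq ep eq.
have [s ds] : exists s : {perm 'I_n}, forall i, (0 < e 0 i) = (0 < d 0 (s i)).
  have [|s ses] := @perm_of_card [set i | 0 < e 0 i]%SET [set i | 0 < d 0 i]%SET.
    by rewrite ep dp.
  by exists s => i; have := ses i; rewrite !inE.
have ed i : 0 < e 0 i / d 0 (s i).
  have [ei|ei] := boolP (0 < e 0 i); first by rewrite divr_gt0 -?ds.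
  have ei' : e 0 i < 0 by rewrite lt_neqAle e0 leNgt.
  by rewrite nmulr_rgt0// invr_lt0 lt_neqAle d0 leNgt -ds.
(* The rows of [W] are the diagonalizing basis of [B], reordered and rescaled
   so as to have the squares [e 0 i]. *)
pose W := \matrix_(i, j) (Num.sqrt (e 0 i / d 0 (s i)) * S (s i) j).
have Wd : W *m B *m W^T = diag_mx e.
  apply/matrixP => i j.
  have -> : (W *m B *m W^T) i j = Num.sqrt (e 0 i / d 0 (s i)) *
      Num.sqrt (e 0 j / d 0 (s j)) * (S *m B *m S^T) (s i) (s j).
    rewrite !mxE mulr_sumr; apply: eq_bigr => k _; rewrite !mxE.
    rewrite mulrACA; congr (_ * _); last first.
    rewrite mulr_sumr; apply: eq_bigr => l _; rewrite !mxE mulrA.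
    by [].
  rewrite Sd !mxE (inj_eq perm_inj); have [->|] := eqVneq i j; last first.
    by rewrite !mulr0n mulr0.
  by rewrite !mulr1n -expr2 sqr_sqrtr ?ltW// divfK.
have uW : W \in unitmx.
  by have := diag_unitmx e0; rewrite -Wd !unitmx_mul => /andP[/andP[]].
exists (W^T *m invmx T^T).
  by rewrite unitmx_mul unitmx_tr uW unitmx_inv unitmx_tr.
rewrite trmx_mul trmx_inv !trmxK -!mulmxA (mulmxA W) (mulmxA (W *m B)) Wd -Te.
by rewrite !mulmxA mulVmx// mul1mx mulmxK// unitmx_tr.
Qed.

End Signature.

(** * The structure group and frames *)

Section Groups.
Variables (R : realType) (n : nat).
Local Notation V := 'M[R]_(n, 2).
Implicit Types (h : V -> V) (g : 'M[R]_n).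

Lemma grassmannian_id : grassmannian_group (id : V -> V).
Proof.
exists 1%:M, 1%:M; split; rewrite ?unitmx1//.
by apply/funext => X; rewrite invmx1 mul1mx mulmx1.
Qed.

Lemma grassmannian_comp h h' :
  grassmannian_group h -> grassmannian_group h' -> grassmannian_group (h \o h').
Proof.
move=> [A [B [uA uB ->]]] [A' [B' [uA' uB' ->]]].
exists (A *m A'), (B *m B'); split; rewrite ?unitmx_mul ?uA ?uB//.
apply/funext => X /=; rewrite !mulmxA -(mulmxA _ (invmx A')); congr (_ *m _).
have uAA' : A *m A' \in unitmx by rewrite unitmx_mul uA.
by apply: (can_inj (mulmxK uAA')); rewrite mulVmx// mulmxA mulmxKV// mulVmx.
Qed.

Lemma grassmannian_inv h : grassmannian_group h ->
  exists h', [/\ grassmannian_group h', cancel h h' & cancel h' h].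
Proof.
move=> [A [B [uA uB ->]]]; exists (fun X => invmx B *m X *m A); split.
- exists (invmx A), (invmx B).
  by rewrite !unitmx_inv invmxK.
- by move=> X; rewrite !mulmxA mulVmx// mul1mx mulmxKV.
- by move=> X; rewrite !mulmxA mulmxV// mul1mx mulmxK.
Qed.

Lemma grassmannian_linear h : grassmannian_group h -> linear h.
Proof.
move=> [A [B [_ _ ->]]] a X Y.
by rewrite mulmxDr mulmxDl -scalemxAr -scalemxAl.
Qed.

Lemma grassmannian_bij h : grassmannian_group h -> bijective h.
Proof. by move=> /grassmannian_inv[h' [_ hK h'K]]; exists h'. Qed.

Lemma grassmannian_vol h : grassmannian_group h ->
  exists c, exists K, [/\ c != 0, K \in unitmx &
    forall g, pullback h (vol_tensor g) = vol_tensor (c *: (K^T *m g *m K))].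
Proof.
move=> [A [B [uA uB ->]]]; exists (\det (invmx A)), B; split=> //.
  by rewrite -unitfE -unitmxE unitmx_inv.
by move=> g; apply/funext => X; apply/funext => Y; rewrite -vol_tensor_mul.
Qed.

Lemma vol_tensor_neq0 g : g \in unitmx -> (0 < n)%N ->
  vol_tensor g <> @zero_form R _.
Proof.
move=> ug n_gt0 g0; pose X : V := const_mx 1.
have : X = 0 by apply: (nondegenerate_vol ug) => Y; rewrite g0.
by move=> /matrixP/(_ (Ordinal n_gt0) 0)/eqP; rewrite !mxE oner_eq0.
Qed.

Definition rescale (U : lmodType R) (a : R) (w : form2 U) : form2 U :=
  fun v v' => a * w v v'.

Lemma rescaleA (U : lmodType R) a b (w : form2 U) :
  rescale a (rescale b w) = rescale (a * b) w.
Proof. by apply/funext => v; apply/funext => v'; rewrite /rescale mulrA. Qed.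

Lemma rescale1 (U : lmodType R) (w : form2 U) : rescale 1 w = w.
Proof. by apply/funext => v; apply/funext => v'; rewrite /rescale mul1r. Qed.

Lemma rescale0 (U : lmodType R) (w : form2 U) : rescale 0 w = @zero_form R U.
Proof. by apply/funext => v; apply/funext => v'; rewrite /rescale mul0r. Qed.

Lemma form_line_refl (U : lmodType R) (w : form2 U) : form_line w w.
Proof. by exists 1; rewrite -[LHS]rescale1. Qed.

Lemma form_line_rescale (U : lmodType R) (w : form2 U) a : a != 0 ->
  form_line (rescale a w) = form_line w.
Proof.
move=> a0; apply/seteqP; split=> [w' [b ->]|w' [b ->]].
  by exists (b * a); rewrite -[LHS]/(rescale _ _) rescaleA.
by exists (b / a); rewrite -[RHS]/(rescale _ _) rescaleA divfK.
Qed.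

(** A linear bijection which stabilizes the line spanned by a nonzero form acts
    on it by an invertible scalar. *)
Lemma CSpP g h : vol_tensor g <> @zero_form R _ ->
  CSp g h <-> [/\ linear h, bijective h &
    exists2 b, b != 0 & pullback h (vol_tensor g) = rescale b (vol_tensor g)].
Proof.
move=> g0; split=> [[[lh bh] hg]|[lh bh [b b0 hg]]].
  split=> //; have [w [a ->] ag] : [set pullback h w | w in
      form_line (vol_tensor g)] (vol_tensor g).
    by rewrite hg; exact: form_line_refl.
  have {}ag : rescale a (pullback h (vol_tensor g)) = vol_tensor g by [].
  have a0 : a != 0.
    by apply/eqP => a0; apply: g0; rewrite -ag a0 rescale0.
  by exists a^-1; rewrite ?invr_eq0// -[in RHS]ag rescaleA mulVf// rescale1.
split=> //; rewrite eqEsubset; split=> [_ [_ [a ->] <-]|_ [a ->]].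
  exists (a * b).
  by rewrite -[RHS]/(rescale (a * b) (vol_tensor g)) -rescaleA -hg.
exists (rescale (a / b) (vol_tensor g)); first by exists (a / b).
rewrite -[LHS]/(rescale (a / b) (pullback h (vol_tensor g))) hg rescaleA.
by rewrite divfK.
Qed.

(** Sufficient condition with a scale on both sides, as it arises when two frames
    are compared; [a] cannot vanish since [b] does not. *)
Lemma CSp_of_pullback g h a b : vol_tensor g <> @zero_form R _ ->
  grassmannian_group h ->
  pullback h (rescale a (vol_tensor g)) = rescale b (vol_tensor g) -> b != 0 ->
  CSp g h.
Proof.
move=> g0 hH hg b0; apply/(CSpP _ g0).
split; [exact: grassmannian_linear|exact: grassmannian_bij|].
have {}hg : rescale a (pullback h (vol_tensor g)) = rescale b (vol_tensor g).
  by [].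
have a0 : a != 0.
  apply/eqP => a0; apply: g0; move: hg; rewrite a0 rescale0.
  move=> /(congr1 (rescale b^-1)); rewrite rescaleA mulVf// rescale1 => <-.
  by apply/funext => X; apply/funext => Y; rewrite /rescale/zero_form mulr0.
exists (a^-1 * b); first by rewrite mulf_neq0 ?invr_eq0.
by rewrite -rescaleA -hg rescaleA mulVf// rescale1.
Qed.

End Groups.

Lemma linear_at0 (R : realType) (U W : lmodType R) (f : U -> W) :
  linear f -> f 0 = 0.
Proof. by move=> lf; have := lf (-1) 0 0; rewrite scaler0 addr0 scaleN1r addNr. Qed.

Section Frames.
Variables (R : realType) (V W : lmodType R).
Implicit Types (u : V -> W).

(** Total so that it can be formed over every point, also where [u] is not known
    to be invertible. *)
Definition frame_inv u (v : W) : V := xget 0 [set X | u X = v].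

Lemma frame_invK u : bijective u -> cancel u (frame_inv u).
Proof.
move=> /bij_inj ui X; rewrite /frame_inv; case: xgetP => [Y _ /ui//|/(_ X) []].
by [].
Qed.

Lemma frame_invKV u : bijective u -> cancel (frame_inv u) u.
Proof.
move=> ub v; have [u' uK u'K] := ub.
by rewrite -{1}[v]u'K frame_invK// u'K.
Qed.

Lemma frame_inv_linear u : linear u -> bijective u -> linear (frame_inv u).
Proof.
move=> lu ub a v v'; apply: (bij_inj ub).
by rewrite lu !frame_invKV.
Qed.

Lemma pullback_frame_inv u (w : form2 V) : bijective u ->
  pullback u (pullback (frame_inv u) w) = w.
Proof.
by move=> ub; apply/funext => X; apply/funext => Y; rewrite /pullback !frame_invK.
Qed.

Lemma pullback_inj u : bijective u -> injective (@pullback R V W u).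
Proof.
move=> [u' uK u'K] w w' ww'; apply/funext => v; apply/funext => v'.
by have := congr1 (fun f => f (u' v) (u' v')) ww'; rewrite /pullback !u'K.
Qed.

End Frames.

Section StructureGroup.
Variables (R : realType) (n : nat) (g : 'M[R]_n).
Hypothesis g_neq0 : vol_tensor g <> @zero_form R _.
Local Notation V := 'M[R]_(n, 2).
Local Notation G0 := (CSp g `&` @grassmannian_group R n).

Lemma G0_pullback h : G0 h ->
  exists2 b, b != 0 & pullback h (vol_tensor g) = rescale b (vol_tensor g).
Proof. by move=> [/(CSpP _ g_neq0)[]]. Qed.

Lemma G0_inv h : G0 h -> exists h', [/\ G0 h', cancel h h' & cancel h' h].
Proof.
move=> h0; have [h' [hH' hK h'K]] := grassmannian_inv h0.2.
exists h'; split=> //; split=> //; have [b b0 hb] := G0_pullback h0.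
apply: (@CSp_of_pullback _ _ _ _ b 1); rewrite ?oner_eq0// rescale1 -hb.
by apply/funext => X; apply/funext => Y; rewrite /pullback !h'K.
Qed.

End StructureGroup.

Lemma linear_funcomp (R : realType) (U V W : lmodType R) (f : V -> W) (h : U -> V) :
  linear f -> linear h -> linear (f \o h).
Proof. by move=> lf lh a u v /=; rewrite lh lf. Qed.

Lemma alternating_pullback (R : realType) (V W : lmodType R) (u : V -> W)
  (w : form2 W) : linear u -> Defs.alternating w -> Defs.alternating (pullback u w).
Proof.
move=> lu [wr wl w0]; split=> [v a v' v''|v a v' v''|v]; rewrite /pullback ?w0//.
  by rewrite lu wr.
by rewrite lu wl.
Qed.

(** * Smooth functions, vector fields and forms on a manifold *)

Section Manifold.
Variables (R : realType) (m : nat) (M : manifold R m).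
Implicit Types (c : chart R M m) (U : set M) (x y : M) (f : M -> R).

(** This image is the preimage of [U] under the inverse of the chart, restricted
    to the open set of values of the chart. *)
Lemma chart_img_open c U : open U -> open (cmap c @` (U `&` cdom c)).
Proof.
move=> oU; rewrite openE => _ [x [Ux cx] <-]; rewrite /interior.
have img : (cmap c @` cdom c) (cmap c x) by exists x.
have nimg : nbhs (cmap c x) (cmap c @` cdom c).
  by apply: open_nbhs_nbhs; split=> //; exact: chart_open_img.
have nU : nbhs (cmap c x) (cinv c @^-1` U).
  apply: (chart_inv_continuous img); rewrite chartK//.
  by apply: open_nbhs_nbhs; split.
apply: filterS2 nimg nU => _ [y cy <-] /=.
by rewrite chartK// => Uy; exists y.
Qed.

(** Chain rule: the composite of the two coordinate changes is the identity near
    [cmap c x]. *)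
Lemma transition_diffK c c' x a : atlas c -> atlas c' -> cdom c x -> cdom c' x ->
  'd (cmap c \o cinv c') (cmap c' x) ('d (cmap c' \o cinv c) (cmap c x) a) = a.
Proof.
move=> ac ac' cx c'x; set h := cmap c \o _; set f := cmap c' \o _.
have fx : f (cmap c x) = cmap c' x by rewrite /f /= chartK.
have df : differentiable f (cmap c x).
  by apply: (transition_smooth ac ac' 1).1; exists x.
have dh : differentiable h (f (cmap c x)).
  by rewrite fx; apply: (transition_smooth ac' ac 1).1; exists x.
rewrite -fx -[LHS]/(('d h (f (cmap c x)) \o 'd f (cmap c x)) a) -diff_comp//.
have hf : \forall z \near cmap c x, idfun z = (h \o f) z.
  apply: (@open_near _ (cmap c @` (cdom c' `&` cdom c))); last by exists x.
    exact/chart_img_open/chart_open_dom.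
  by move=> _ [y [c'y cy] <-]; rewrite /h /f /= !chartK.
have [//|_ ->] := near_eq_differentiable hf.
by rewrite diff_val.
Qed.

Lemma tan_toK c x (v : tangent x) : atlas c -> cdom c x ->
  tan_from c x (tan_to c v) = v.
Proof.
move=> ac cx; apply: transition_diffK => //; first exact: chart_at_atlas.
exact: chart_at_dom.
Qed.

Lemma tan_to_linear c x : linear (@tan_to R m M c x).
Proof. exact: linearP. Qed.

Lemma tan_from_linear c x : linear (@tan_from R m M c x).
Proof. exact: linearP. Qed.

(** Smoothness is required in every chart rather than in one chart around each
    point, to match smooth vector fields and smooth forms; so they
    combine without changing charts. *)
Definition smooth_fun U f : Prop := forall c, atlas c ->
  smooth_on (cmap c @` (U `&` cdom c)) (f \o cinv c).

Lemma smooth_fun_subset U U' f : U' `<=` U -> smooth_fun U f -> smooth_fun U' f.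
Proof.
move=> U'U sf c ac; apply: smooth_subset (sf c ac).
by move=> _ [y [/U'U Uy cy] <-]; exists y.
Qed.

Lemma smooth_fun_continuous U f x : open U -> U x -> smooth_fun U f ->
  {for x, continuous f}.
Proof.
move=> oU Ux sf; set c := chart_at x.
have cx : cdom c x by exact: chart_at_dom.
have cf : {for cmap c x, continuous (f \o cinv c)}.
  by apply: (sf c (chart_at_atlas x) 0); exists x.
have fc : {for x, continuous ((f \o cinv c) \o cmap c)}.
  by apply: continuous_comp cf; exact: chart_continuous.
have fE : \near x, ((f \o cinv c) \o cmap c) x = f x.
  apply: (@open_near _ (cdom c)) => //; first exact: chart_open_dom.
  by move=> y cy /=; rewrite chartK.
have fx : f y @[y --> x] --> ((f \o cinv c) \o cmap c) x.
  by apply: cvg_trans fc; exact: near_eq_cvg.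
by move: fx; rewrite /= chartK.
Qed.

Section Algebra.
Variable U : set M.
Hypothesis oU : open U.

Lemma smooth_fun_congr f f' : (forall y, U y -> f y = f' y) ->
  smooth_fun U f -> smooth_fun U f'.
Proof.
move=> ff' sf c ac; apply: smooth_congr (sf c ac); first exact: chart_img_open.
by move=> _ [y [Uy cy] <-] /=; rewrite chartK// ff'.
Qed.

Lemma smooth_fun_cst a : smooth_fun U (fun=> a).
Proof. by move=> c ac; apply: smooth_cst; exact: chart_img_open. Qed.

Lemma smooth_funD f f' : smooth_fun U f -> smooth_fun U f' ->
  smooth_fun U (fun y => f y + f' y).
Proof.
move=> sf sf' c ac; apply: smoothD; [exact: chart_img_open|exact: sf|exact: sf'].
Qed.

Lemma smooth_funM f f' : smooth_fun U f -> smooth_fun U f' ->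
  smooth_fun U (fun y => f y * f' y).
Proof.
move=> sf sf' c ac; apply: smoothM; [exact: chart_img_open|exact: sf|exact: sf'].
Qed.

Lemma smooth_funV f : (forall y, U y -> f y != 0) -> smooth_fun U f ->
  smooth_fun U (fun y => (f y)^-1).
Proof.
move=> f0 sf c ac; apply: smoothV; [exact: chart_img_open| |exact: sf].
by move=> _ [y [Uy cy] <-] /=; rewrite chartK// f0.
Qed.

Lemma smooth_fun_sqrt f : (forall y, U y -> 0 < f y) -> smooth_fun U f ->
  smooth_fun U (fun y => Num.sqrt (f y)).
Proof.
move=> f0 sf c ac; apply: smooth_sqrt; [exact: chart_img_open| |exact: sf].
by move=> _ [y [Uy cy] <-] /=; rewrite chartK// f0.
Qed.

Lemma smooth_fun_sum (I : Type) (r : seq I) (f : I -> M -> R) :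
  (forall i, smooth_fun U (f i)) ->
  smooth_fun U (fun y => \sum_(i <- r) f i y).
Proof.
move=> sf c ac; apply: smooth_sum; first exact: chart_img_open.
by move=> i _; exact: sf.
Qed.

Definition smooth_mx p q (F : M -> 'M[R]_(p, q)) : Prop :=
  forall i j, smooth_fun U (fun y => F y i j).

Lemma smooth_mx_cst p q (K : 'M[R]_(p, q)) : smooth_mx (fun=> K).
Proof. by move=> i j; exact: smooth_fun_cst. Qed.

Lemma smooth_mxM p q r (F : M -> 'M[R]_(p, q)) (G : M -> 'M[R]_(q, r)) :
  smooth_mx F -> smooth_mx G -> smooth_mx (fun y => F y *m G y).
Proof.
move=> sF sG i k.
have := @smooth_fun_sum _ (index_enum 'I_q) (fun j y => F y i j * G y j k)
  (fun j => smooth_funM (sF i j) (sG j k)).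
by apply: smooth_fun_congr => y _; rewrite mxE.
Qed.

Lemma smooth_mxT p q (F : M -> 'M[R]_(p, q)) :
  smooth_mx F -> smooth_mx (fun y => (F y)^T).
Proof. by move=> sF i j; apply: smooth_fun_congr (sF j i) => y _; rewrite mxE. Qed.

Lemma smooth_mxD p q (F G : M -> 'M[R]_(p, q)) :
  smooth_mx F -> smooth_mx G -> smooth_mx (fun y => F y + G y).
Proof.
move=> sF sG i j; apply: smooth_fun_congr (smooth_funD (sF i j) (sG i j)) => y _.
by rewrite mxE.
Qed.

Lemma smooth_mxZ p q f (F : M -> 'M[R]_(p, q)) :
  smooth_fun U f -> smooth_mx F -> smooth_mx (fun y => f y *: F y).
Proof.
move=> sf sF i j; apply: smooth_fun_congr (smooth_funM sf (sF i j)) => y _.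
by rewrite mxE.
Qed.

Lemma smooth_mx_block p1 p2 q1 q2 (F : M -> 'M[R]_(p1, q1))
    (G : M -> 'M[R]_(p1, q2)) (H : M -> 'M[R]_(p2, q1))
    (K : M -> 'M[R]_(p2, q2)) :
  smooth_mx F -> smooth_mx G -> smooth_mx H -> smooth_mx K ->
  smooth_mx (fun y => block_mx (F y) (G y) (H y) (K y)).
Proof.
move=> sF sG sH sK i j.
rewrite -[i]splitK -[j]splitK.
case: (fintype.split i) => i'; case: (fintype.split j) => j' /=.
- by apply: smooth_fun_congr (sF i' j') => y _; rewrite block_mxEul.
- by apply: smooth_fun_congr (sG i' j') => y _; rewrite block_mxEur.
- by apply: smooth_fun_congr (sH i' j') => y _; rewrite block_mxEdl.
- by apply: smooth_fun_congr (sK i' j') => y _; rewrite block_mxEdr.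
Qed.

End Algebra.

Lemma smooth_mx_subset U U' p q (F : M -> 'M[R]_(p, q)) :
  U' `<=` U -> smooth_mx U F -> smooth_mx U' F.
Proof. by move=> U'U sF i j; exact: smooth_fun_subset (sF i j). Qed.

End Manifold.

Lemma bilinear_row (R : realType) (V : lmodType R) (m : nat)
    (phi : 'rV[R]_m -> V) (w : form2 V) (a b : 'rV[R]_m) :
  linear phi -> (forall v, scalar (w v)) -> (forall v, scalar (w^~ v)) ->
  w (phi a) (phi b) = \sum_i \sum_j a 0 i * b 0 j *
    w (phi (delta_mx 0 i)) (phi (delta_mx 0 j)).
Proof.
move=> lphi wr wl.
pose phiL : {linear 'rV[R]_m -> V} :=
  HB.pack phi (GRing.isLinear.Build _ _ _ _ phi lphi).
have sum_phi c : phi c = \sum_i c 0 i *: phi (delta_mx 0 i).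
  rewrite [in LHS](row_sum_delta c) -[LHS]/(phiL _) linear_sum.
  by apply: eq_bigr => i _; rewrite linearZ.
have wl_sum v (F : 'I_m -> V) : w (\sum_i F i) v = \sum_i w (F i) v.
  pose wL : {linear V -> R^o} :=
    HB.pack (w^~ v) (GRing.isLinear.Build _ _ _ _ (w^~ v) (wl v)).
  exact: (linear_sum wL).
have wr_sum v (F : 'I_m -> V) : w v (\sum_i F i) = \sum_i w v (F i).
  pose wL : {linear V -> R^o} :=
    HB.pack (w v) (GRing.isLinear.Build _ _ _ _ (w v) (wr v)).
  exact: (linear_sum wL).
have wlZ c v v' : w (c *: v) v' = c * w v v'.
  pose wL : {linear V -> R^o} :=
    HB.pack (w^~ v') (GRing.isLinear.Build _ _ _ _ (w^~ v') (wl v')).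
  by rewrite -[LHS]/(wL _) linearZ.
have wrZ c v v' : w v (c *: v') = c * w v v'.
  pose wL : {linear V -> R^o} :=
    HB.pack (w v) (GRing.isLinear.Build _ _ _ _ (w v) (wr v)).
  by rewrite -[LHS]/(wL _) linearZ.
rewrite (sum_phi a) (sum_phi b) wl_sum; apply: eq_bigr => i _.
rewrite wr_sum; apply: eq_bigr => j _.
by rewrite wlZ wrZ mulrA.
Qed.

Section Fields.
Variables (R : realType) (m : nat) (M : manifold R m) (U : set M).
Hypothesis oU : open U.

(** A smooth form is smooth by definition on constant coordinate fields only;
    expand both fields in these. *)
Lemma smooth_form2_eval (w : forall y : M, form2 (tangent y))
    (X Y : forall y : M, tangent y) :
  (forall y, U y -> Defs.alternating (w y)) -> smooth_form2 U w ->
  smooth_vector_field U X -> smooth_vector_field U Y ->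
  smooth_fun U (fun y => w y (X y) (Y y)).
Proof.
move=> aw sw sX sY c ac; have oI := @chart_img_open _ _ _ c _ oU.
pose S z i j := (tan_to c (X (cinv c z))) 0 i * (tan_to c (Y (cinv c z))) 0 j *
  w (cinv c z) (tan_from c (cinv c z) (delta_mx 0 i))
               (tan_from c (cinv c z) (delta_mx 0 j)).
apply: (@smooth_congr _ _ _ oI _ (fun z => \sum_i \sum_j S z i j)).
  move=> _ [y [Uy cy] <-]; rewrite /S /= chartK//.
  rewrite -[in RHS](@tan_toK _ _ _ c _ (X y))// -[in RHS](@tan_toK _ _ _ c _ (Y y))//.
  have [wr wl _] := aw _ Uy.
  by rewrite (bilinear_row _ _ (@tan_from_linear _ _ _ c y) wr wl).
apply: smooth_sum => // i _; apply: smooth_sum => // j _.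
apply: smoothM => //; last exact: sw.
by apply: smoothM => //; apply: smooth_coord => //; [exact: sX|exact: sY].
Qed.

Lemma smooth_field_comb (I : Type) (r : seq I) (f : I -> M -> R)
    (X : I -> forall y : M, tangent y) :
  (forall i, smooth_fun U (f i)) -> (forall i, smooth_vector_field U (X i)) ->
  smooth_vector_field U (fun y => \sum_(i <- r) f i y *: X i y).
Proof.
move=> sf sX c ac; have oI := @chart_img_open _ _ _ c _ oU.
apply: smooth_row => // j.
apply: (@smooth_congr _ _ _ oI _ (fun z => \sum_(i <- r)
    f i (cinv c z) * (tan_to c (X i (cinv c z))) 0 j)).
  move=> z _; rewrite /tan_to linear_sum summxE; apply: eq_bigr => i _.
  by rewrite linearZ mxE.
apply: smooth_sum => // i _; apply: smoothM => //; first exact: sf.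
by apply: smooth_coord => //; exact: sX.
Qed.

(** The constant form [w] transported to the tangent spaces by a smooth frame.  In
    a chart the inverse frame is the inverse of the matrix [S] of components of
    the frame, hence smooth by Cramer's rule.  The linear injection [phi] chooses
    coordinates on [V] and, by injectivity of [s y], makes this matrix invertible. *)
Lemma smooth_frame_form (V : lmodType R) (phi : 'rV[R]_m -> V)
    (s : forall y : M, V -> tangent y) (w : form2 V) :
  linear phi -> injective phi ->
  (forall v, scalar (w v)) -> (forall v, scalar (w^~ v)) ->
  (forall y, U y -> linear (s y) /\ bijective (s y)) ->
  (forall v, smooth_vector_field U (fun y => s y v)) ->
  smooth_form2 U (fun y => pullback (frame_inv (s y)) w).
Proof.
move=> lphi iphi wr wl sU ss c ac a b; have oI := @chart_img_open _ _ _ c _ oU.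
pose S z : 'M[R]_m :=
  \matrix_i tan_to c (s (cinv c z) (phi (delta_mx 0 i))).
have SE y e : U y -> cdom c y -> e *m S (cmap c y) = tan_to c (s y (phi e)).
  move=> Uy cy; have [ls _] := sU _ Uy.
  have lt : linear (fun e => tan_to c (s y (phi e))).
    by move=> k e1 e2; rewrite lphi ls tan_to_linear.
  pose tL : {linear 'rV[R]_m -> 'rV[R]_m} :=
    HB.pack (fun e => tan_to c (s y (phi e))) (GRing.isLinear.Build _ _ _ _ _ lt).
  rewrite -[RHS]/(tL e) [in RHS](row_sum_delta e) linear_sum mulmx_sum_row.
  apply: eq_bigr => i _; rewrite linearZ; congr (_ *: _).
  by rewrite rowK chartK.
have uS z : (cmap c @` (U `&` cdom c)) z -> S z \in unitmx.
  move=> [y [Uy cy] <-]; rewrite -row_free_unit; apply: inj_row_free => e.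
  rewrite SE// => /(congr1 (tan_from c y)); rewrite tan_toK//.
  have [ls bs] := sU _ Uy.
  move=> sphi0; apply: iphi; apply: (bij_inj bs).
  rewrite sphi0 (linear_at0 lphi) (linear_at0 ls).
  exact: linear_at0 (@tan_from_linear _ _ _ c y).
have inv_s y e : U y -> cdom c y ->
    frame_inv (s y) (tan_from c y e) = phi (e *m invmx (S (cmap c y))).
  move=> Uy cy; have [ls bs] := sU _ Uy; apply: (bij_inj bs).
  rewrite frame_invKV// -[RHS](@tan_toK _ _ _ c)// -SE// mulmxKV//.
  by apply: uS; exists y.
(* [T e z] lists the coordinates in the frame of the constant field [e]. *)
pose T (e z : 'rV[R]_m) i : R := (e *m invmx (S z)) 0 i.
have sT e i : smooth_on (cmap c @` (U `&` cdom c)) (fun z => T e z i).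
  apply: (@smooth_congr _ _ _ oI _ (fun z => \sum_j e 0 j * invmx (S z) j i)).
    by move=> z _; rewrite /T mxE.
  apply: smooth_sum => // j _; apply: smoothM => //; first exact: smooth_cst.
  apply: smooth_invmx => // k l.
  apply: (@smooth_congr _ _ _ oI _
    (fun z => (tan_to c (s (cinv c z) (phi (delta_mx 0 k)))) 0 l)).
    by move=> z _; rewrite mxE.
  by apply: smooth_coord => //; exact: ss.
apply: (@smooth_congr _ _ _ oI _ (fun z => \sum_i \sum_j T a z i * T b z j *
    w (phi (delta_mx 0 i)) (phi (delta_mx 0 j)))).
  move=> _ [y [Uy cy] <-]; rewrite chartK// /pullback !inv_s//.
  by rewrite (bilinear_row _ _ lphi wr wl).
apply: smooth_sum => // i _; apply: smooth_sum => // j _.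
by apply: smoothM => //; [apply: smoothM|exact: smooth_cst].
Qed.

End Fields.

Lemma row_matrix_iso (R : realType) (n : nat) :
  exists phi : 'rV[R]_(2 * n) -> 'M[R]_(n, 2), linear phi /\ injective phi.
Proof.
rewrite mulnC; exists vec_mx; split; first exact: linearP.
exact: can_inj vec_mxK.
Qed.

(** * Smooth diagonalization of symmetric matrices *)

Section Sylvester.
Variables (R : realType) (m : nat) (M : manifold R m).

(** Near a point where it is diagonal and invertible, a smooth family of symmetric
    matrices is congruent to its value at that point by a smooth family of matrices.
    Completing the square splits off the first coordinate: with
    [B = block_mx a b b^T D], the matrix [block_mx r (- a^-1 b C) 0 C] turns [B] into
    [block_mx (r^2 a) 0 0 (C^T (D - a^-1 b^T b) C)].  The smooth factor
    [r = sqrt (d_0 / a)] restores the first diagonal entry [d_0], and [C] comes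
    from induction applied to the Schur complement [D - a^-1 b^T b], whose value at
    the point is still diagonal because [b] vanishes there. *)
Lemma smooth_sylvester n (d : 'rV[R]_n) (B : M -> 'M[R]_n) (U : set M) x :
  (forall i, d 0 i != 0) -> open U -> U x -> smooth_mx U B ->
  (forall y, U y -> (B y)^T = B y) -> B x = diag_mx d ->
  exists U' : set M, exists C : M -> 'M[R]_n,
    [/\ open U', U' x, U' `<=` U, smooth_mx U' C &
        forall y, U' y -> (C y)^T *m B y *m C y = diag_mx d].
Proof.
elim: n => [|n IH] in d B U *.
  move=> _ oU Ux _ _ _; exists U, (fun=> 0); split=> //; first by case.
  by move=> y _; apply/matrixP => -[].
move: d B; rewrite -[n.+1]/(1 + n)%N => d B d0 oU Ux sB symB Bx.
pose a y := B y 0 0; pose b y := ursubmx (B y); pose D y := drsubmx (B y).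
have sa : smooth_fun U a by exact: sB.
have sb : smooth_mx U b.
  move=> i j; apply: smooth_fun_congr (sB (lshift n i) (rshift 1 j)) => // y _.
  by rewrite !mxE.
have sD : smooth_mx U D.
  move=> i j; apply: smooth_fun_congr (sB (rshift 1 i) (rshift 1 j)) => // y _.
  by rewrite !mxE.
have BE y : U y -> B y = block_mx (a y)%:M (b y) (b y)^T (D y).
  move=> Uy; rewrite -[LHS]submxK /b trmx_ursub symB//; congr block_mx.
  by rewrite [LHS]mx11_scalar !mxE; congr (B y _ _)%:M; exact: val_inj.
have := Bx; rewrite -[d]hsubmxK diag_mx_row BE// => /eq_block_mx[ax bx _ Dx].
have {ax}ax0 : a x = d 0 0.
  have := congr1 (fun K : 'M[R]_1 => K 0 0) ax; rewrite !mxE /= !mulr1n => ->.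
  by congr (d _ _); exact: val_inj.
(* Nearby, [a] keeps the sign that it has at [x], so that [r] makes sense. *)
have [G [oG Gx GU aG]] : exists G : set M, [/\ open G, G x, G `<=` U &
    forall y, G y -> 0 < a y / d 0 0].
  pose G := U `&` [set y | 0 < a y / d 0 0].
  exists G; split; last 2 first.
  - by move=> y [].
  - by move=> y [].
  - rewrite openE => y [Uy ay]; rewrite /interior.
    apply: filterI; first exact: open_nbhs_nbhs.
    have ca : {for y, continuous (fun y => a y / d 0 0)}.
      apply: (smooth_fun_continuous oU Uy).
      by apply: smooth_funM => //; exact: smooth_fun_cst.
    by move/cvgr_gt : ca; exact.
  - by split=> //=; rewrite ax0 divff.
have a0 y : G y -> a y != 0.
  by move=> /aG; apply: contraTneq => ->; rewrite mul0r ltxx.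
have saG := smooth_fun_subset GU sa.
have sbG := smooth_mx_subset GU sb.
pose B' y := D y - (a y)^-1 *: ((b y)^T *m b y).
have sB' : smooth_mx G B'.
  have sV : smooth_fun G (fun y => -1 * (a y)^-1).
    by apply: smooth_funM => //; [exact: smooth_fun_cst|exact: smooth_funV].
  have := smooth_mxD oG (smooth_mx_subset GU sD)
    (smooth_mxZ oG sV (smooth_mxM oG (smooth_mxT oG sbG) sbG)).
  move=> sK i j; apply: smooth_fun_congr (sK i j) => // y _.
  by rewrite mulN1r scaleNr.
have symD y : U y -> (D y)^T = D y by move=> Uy; rewrite /D trmx_drsub symB.
have symB' y : G y -> (B' y)^T = B' y.
  move=> Gy; rewrite /B' linearB linearZ /= trmx_mul trmxK symD//; exact: GU.
have B'x : B' x = diag_mx (rsubmx d).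
  by rewrite /B' Dx bx mulmx0 scaler0 subr0.
have d'0 i : rsubmx d 0 i != 0 by rewrite mxE.
have [U' [C [oU' U'x U'G sC Cd]]] := IH _ _ _ d'0 oG Gx sB' symB' B'x.
pose r y := (Num.sqrt (a y / d 0 0))^-1.
have sr : smooth_fun U' r.
  apply: smooth_funV => //.
    by move=> y /U'G Gy; rewrite gt_eqF// sqrtr_gt0 aG.
  apply: smooth_fun_sqrt => //; first by move=> y /U'G; exact: aG.
  apply: smooth_funM => //; last exact: smooth_fun_cst.
  exact: smooth_fun_subset saG.
have rE y : G y -> r y * r y * a y = d 0 0.
  move=> Gy; rewrite /r -invfM -expr2 sqr_sqrtr ?ltW ?aG//.
  by rewrite invf_div divfK ?a0.
pose e y : 'rV[R]_n := (-1 * (a y)^-1) *: (b y *m C y).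
exists U', (fun y => block_mx (r y)%:M (e y) 0 (C y)); split=> //.
- exact: subset_trans GU.
- apply: smooth_mx_block => //.
  + move=> i j; apply: smooth_fun_congr sr => // y _.
    by rewrite !ord1 mxE mulr1n.
  + apply: smooth_mxZ => //.
      apply: smooth_funM => //; first exact: smooth_fun_cst.
      apply: smooth_funV => //; first by move=> y /U'G; exact: a0.
      exact: smooth_fun_subset saG.
    apply: smooth_mxM => //; exact: smooth_mx_subset sbG.
  + exact: smooth_mx_cst.
move=> y U'y; have Gy := U'G _ U'y.
have Uy := GU _ Gy; rewrite (BE _ Uy).
rewrite -(Cd _ U'y) tr_block_mx !tr_scalar_mx trmx0.
rewrite !mulmx_block !mul0mx !mulmx0 !addr0.
have ae : (a y)%:M *m e y = - (b y *m C y).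
  by rewrite mul_scalar_mx scalerA mulN1r mulrN mulfV ?a0// scaleN1r.
have bC : (e y)^T *m (a y)%:M = - ((C y)^T *m (b y)^T).
  by rewrite -[LHS]trmxK trmx_mul trmxK tr_scalar_mx ae linearN /= trmx_mul.
have ur0 : (r y)%:M *m (a y)%:M *m e y + (r y)%:M *m b y *m C y = 0.
  by rewrite -!mulmxA ae mulmxN addNr.
have dl0 : (e y)^T *m (a y)%:M + (C y)^T *m (b y)^T = 0 by rewrite bC addNr.
rewrite !mulmxDl ur0 -[X in block_mx _ _ X _]mulmxDl dl0 mul0mx.
congr block_mx.
  rewrite -!scalar_mxM mulrAC rE//; apply/matrixP => i j.
  by rewrite !ord1 !mxE; congr (d _ _ *+ _); exact: val_inj.
rewrite -[X in X + _ = _]mulmxDl dl0 mul0mx add0r -[LHS]mulmxDl.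
congr (_ *m _); rewrite /B' mulmxBr addrC; congr (_ + _).
rewrite -scalemxAr /e linearZ /= mulN1r scaleNr mulNmx -scalemxAl trmx_mul.
by rewrite mulmxA.
Qed.

End Sylvester.

(** * The two constructions *)

Section Equivalence.
#[local] Arguments induced_line {R n} g {m M} P x _.
#[local] Arguments induced_grassmannian {R n m M} P x _.
Variables (R : realType) (n : nat) (g : 'M[R]_n).
Hypothesis g_sym : g^T = g.
Hypothesis g_unit : g \in unitmx.
Hypothesis n_gt0 : (0 < n)%N.
Variables (m : nat) (M : manifold R m).
Local Notation V := 'M[R]_(n, 2).
Local Notation G0 := (CSp g `&` @grassmannian_group R n).
Local Notation frames := (forall x : M, set (V -> tangent x) : Type).
Local Notation lines := (forall x : M, set (form2 (tangent x))).

Let g0 : vol_tensor g <> @zero_form R _ := vol_tensor_neq0 g_unit n_gt0.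

(** The frames of [Q] in which the model form spans the line: the inverse
    construction. *)
Definition adapted_frames (Q : frames) (l : lines) : frames :=
  fun x => [set u | Q x u /\ exists2 w, l x w & pullback u w = vol_tensor g].

Section Induced.
Variable P : frames.
Arguments P : clear implicits.
Hypothesis P_pacs : PACS_structure g P.

Let P_iso x u : P x u -> linear u /\ bijective u.
Proof. by have [h _ _] := P_pacs; exact: h. Qed.

Let P_orbit x u : P x u -> P x = [set u \o h | h in G0].
Proof. by have [_ h _] := P_pacs; exact: h. Qed.

(** Two frames of [P x] differ by an element of the structure group, which
    preserves the model line, so the condition may be tested in any one frame. *)
Lemma induced_lineE x u : P x u ->
  induced_line g P x = [set w | form_line (vol_tensor g) (pullback u w)].
Proof.
move=> Pu; apply/seteqP; split=> [w [v Pv vw]|w uw]; last by exists u.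
move: (Pv); rewrite (P_orbit Pu) => -[h h0 vE].
have [h' [h0' _ h'K]] := G0_inv g0 h0; have [b b0 hb] := G0_pullback g0 h0'.
have {vw}[a va] := vw.
exists (a * b); rewrite -[RHS]/(rescale (a * b) (vol_tensor g)) -rescaleA -hb.
rewrite -[RHS]/(pullback h' (rescale a (vol_tensor g))).
rewrite -[rescale a _]va -vE.
by apply/funext => X; apply/funext => Y; rewrite /pullback /= !h'K.
Qed.

Lemma induced_lineE_line x u : P x u ->
  induced_line g P x = form_line (pullback (frame_inv u) (vol_tensor g)).
Proof.
move=> Pu; have [_ bu] := P_iso Pu; rewrite (induced_lineE Pu).
apply/seteqP; split=> w [a wE]; exists a.
  apply: (pullback_inj bu); rewrite wE.
  by rewrite -[RHS]/(rescale a (pullback u (pullback (frame_inv u) _)))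
    pullback_frame_inv.
rewrite wE -[LHS]/(rescale a (pullback u (pullback (frame_inv u) _))).
by rewrite pullback_frame_inv.
Qed.

Lemma induced_almost_grassmannian :
  almost_grassmannian (induced_grassmannian P).
Proof.
split=> [x _ [u Pu [h hH <-]]|x _ [u Pu [h hH <-]]|x].
- have [lu bu] := P_iso Pu; split.
    exact: linear_funcomp lu (grassmannian_linear hH).
  exact: bij_comp bu (grassmannian_bij hH).
- have [h' [hH' hK h'K]] := grassmannian_inv hH.
  apply/seteqP; split=> [_ [v Pv [k kH <-]]|_ [k kH <-]]; last first.
    by exists u => //; exists (h \o k) => //; exact: grassmannian_comp.
  move: Pv; rewrite (P_orbit Pu) => -[h0 [_ h0H] <-].
  exists (h' \o (h0 \o k)).
    by do !apply: grassmannian_comp => //.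
  by apply/funext => X /=; rewrite h'K.
- have [_ _ /(_ x)[U [s [oU Ux sP ss]]]] := P_pacs.
  exists U, s; split=> // y Uy; exists (s y); first exact: sP.
  by exists id; first exact: grassmannian_id.
Qed.

(** A local section of [P] transports the model form to a smooth generator of the
    line.  The dimension is what makes the frames square matrices in a chart. *)
Lemma induced_almost_conformally_symplectic (mE : m = (2 * n)%N) :
  almost_conformally_symplectic (induced_line g P).
Proof.
have P_sec : forall x : M, exists U : set M,
    exists s : forall y : M, V -> tangent y, [/\ open U, U x, forall y, U y -> P y (s y) &
        forall v, smooth_vector_field U (fun y => s y v)].
  by have [] := P_pacs.
split=> [x|x w].
  have [U [s [oU Ux sP ss]]] := P_sec x.
  exists U, (fun y => pullback (frame_inv (s y)) (vol_tensor g)); split=> //.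
    have [phi [lphi iphi]] : exists phi : 'rV[R]_m -> V, linear phi /\ injective phi.
      by rewrite mE; exact: row_matrix_iso.
    apply: (smooth_frame_form oU lphi iphi) => //.
    - by move=> X; exact: vol_tensor_linearr.
    - by move=> Y; exact: vol_tensor_linearl.
    - by move=> y /sP/P_iso.
  move=> y Uy; have Ps := sP _ Uy; have [ls bs] := P_iso Ps.
  split; last exact: induced_lineE_line.
    apply: alternating_pullback; first exact: frame_inv_linear.
    exact: alternating_vol.
  move=> s0; apply: g0; rewrite -(pullback_frame_inv (vol_tensor g) bs) s0.
  by [].
have [U [s [oU Ux sP ss]]] := P_sec x; have Ps := sP _ Ux.
have [ls bs] := P_iso Ps.
rewrite (induced_lineE_line Ps) => -[a ->] w0 v v0.
have a0 : a != 0.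
  apply/eqP => a0; apply: w0; rewrite a0.
  exact: (rescale0 (pullback (frame_inv (s x)) (vol_tensor g))).
have sv0 : frame_inv (s x) v = 0.
  apply: (nondegenerate_vol g_unit) => Y.
  have := v0 (s x Y); rewrite /pullback frame_invK// => /eqP.
  by rewrite mulf_eq0 (negbTE a0) => /eqP.
by rewrite -[v](frame_invKV bs) sv0 (linear_at0 ls).
Qed.

(** A frame of the extended structure differs from one of [P] by an element of the
    Grassmannian group, so it sees the model form up to congruence and scale. *)
Lemma induced_pullback x w u : induced_line g P x w ->
  induced_grassmannian P x u ->
  exists a c K, [/\ c != 0, K \in unitmx &
    pullback u w = vol_tensor (a *: (c *: (K^T *m g *m K)))].
Proof.
move=> lw [v Pv [h hH <-]]; move: lw; rewrite (induced_lineE Pv) => -[a vw].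
have [c [K [c0 uK hK]]] := grassmannian_vol hH.
exists a, c, K; split=> //.
rewrite -[LHS]/(pullback h (pullback v w)) vw.
rewrite -[LHS]/(rescale a (pullback h (vol_tensor g))) hK.
by apply/funext => X; apply/funext => Y; rewrite vol_tensorZ.
Qed.

Let induced_sym a c (K : 'M[R]_n) :
  (a *: (c *: (K^T *m g *m K)))^T = a *: (c *: (K^T *m g *m K)).
Proof. by rewrite linearZ /= linearZ /= !trmx_mul trmxK g_sym mulmxA. Qed.

Lemma induced_hermitian :
  hermitian_line (induced_grassmannian P) (induced_line g P).
Proof.
move=> x w lw; have [u Pu _] := lw.
have Qu : induced_grassmannian P x u.
  by exists u => //; exists id => //; exact: grassmannian_id.
exists u => //; have [a [c [K [_ _ uw]]]] := induced_pullback lw Qu.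
by exists (a *: (c *: (K^T *m g *m K))); first exact: induced_sym.
Qed.

Lemma induced_signature p q : signature g p q ->
  line_signature (induced_grassmannian P) (induced_line g P) p q.
Proof.
move=> gpq x w u lw w0 Qu.
have [a [c [K [c0 uK uw]]]] := induced_pullback lw Qu.
exists (a *: (c *: (K^T *m g *m K))).
  by split; first exact: induced_sym.
have a0 : a != 0.
  apply/eqP => a0; apply: w0.
  have [_ bu] : linear u /\ bijective u.
    by have [h _ _] := induced_almost_grassmannian; exact: h Qu.
  apply: (pullback_inj bu); rewrite uw a0.
  by apply/funext => X; apply/funext => Y; rewrite vol_tensorZ mul0r.
have Kpq := signature_congr uK gpq; rewrite scalerA.
have : a * c != 0 by rewrite mulf_neq0.
rewrite neq_lt => /orP[ac|ac].
  by right; exact: signature_scale_lt0.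
by left; exact: signature_scale_gt0.
Qed.

(** If a frame [v \o h], with [v] in [P x] and [h] in the Grassmannian group, is
    adapted, then [h] preserves the model line and hence lies in the structure
    group.  So [P] can be recovered from the induced pair. *)
Lemma adapted_frames_induced :
  adapted_frames (induced_grassmannian P) (induced_line g P) = P.
Proof.
apply/functional_extensionality_dep => x; apply/seteqP; split=> u.
  move=> [[v Pv [h hH <-]] [w lw hw]].
  rewrite (P_orbit Pv); exists h => //; split=> //.
  move: lw; rewrite (induced_lineE Pv) => -[a vw].
  apply: (@CSp_of_pullback _ _ _ _ a 1); rewrite ?oner_eq0//.
  by rewrite rescale1 -[rescale a _]vw; exact: hw.
move=> Pu; have [_ bu] := P_iso Pu; split.
  by exists u => //; exists id => //; exact: grassmannian_id.
exists (pullback (frame_inv u) (vol_tensor g)); last exact: pullback_frame_inv.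
by rewrite (induced_lineE_line Pu); exact: form_line_refl.
Qed.

End Induced.

Section Reduced.
Variables (p q : nat) (pq : (p + q = n)%N) (g_sig : signature g p q).
Variables (Q : frames) (l : lines).
Arguments Q : clear implicits.
Arguments l : clear implicits.
Hypothesis Q_gr : almost_grassmannian Q.
Hypothesis l_acs : almost_conformally_symplectic l.
Hypothesis l_sig : line_signature Q l p q.

Local Notation P := (adapted_frames Q l).

Let Q_iso x u : Q x u -> linear u /\ bijective u.
Proof. by have [h _ _] := Q_gr; exact: h. Qed.

Let Q_orbit x u : Q x u -> Q x = [set u \o h | h in @grassmannian_group R n].
Proof. by have [_ h _] := Q_gr; exact: h. Qed.

(** Local sections exist: start from a local section [s1] of [Q] and a local
    generator [w] of [l].  In the frame [s1] the form [w] is given by a smooth family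
    [B] of symmetric matrices of signature [(p, q)] or [(q, p)]; in the second
    case replace [w] by [- w].  A constant change of basis of [R^n] makes
    [B] diagonal at [x], the smooth version of Sylvester's theorem makes it constant
    near [x], and another constant change of basis turns it into [g]. *)
Lemma adapted_frames_section (x : M) :
  exists U : set M, exists s : forall y : M, V -> tangent y,
    [/\ open U, U x, forall y, U y -> P (s y) &
        forall v, smooth_vector_field U (fun y => s y v)].
Proof.
have [_ _ /(_ x)[U1 [s1 [oU1 U1x s1Q ss1]]]] := Q_gr.
have [/(_ x)[U2 [w [oU2 U2x sw lw]]] _] := l_acs.
pose U := U1 `&` U2; have oU : open U by exact: openI.
have Ux : U x by split.
have UU1 : U `<=` U1 by move=> y [].
have UU2 : U `<=` U2 by move=> y [].
have subf (U' : set M) (X : forall y : M, tangent y) : U' `<=` U1 ->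
    smooth_vector_field U1 X -> smooth_vector_field U' X.
  move=> U'U sX c ac; apply: smooth_subset (sX c ac).
  by move=> _ [y [/U'U Uy cy] <-]; exists y.
have sw' : smooth_form2 U w.
  move=> c ac a b; apply: smooth_subset (sw c ac a b).
  by move=> _ [y [/UU2 Uy cy] <-]; exists y.
pose B y : 'M[R]_n :=
  \matrix_(i, j) w y (s1 y (delta_mx i 0)) (s1 y (delta_mx j 1)).
have BP y : U y -> [/\ (B y)^T = B y, pullback (s1 y) (w y) = vol_tensor (B y) &
    signature (B y) p q \/ signature (B y) q p].
  move=> Uy; have [aw w0 lE] := lw _ (UU2 _ Uy).
  have lyw : l y (w y) by rewrite lE; exact: form_line_refl.
  have [B' [symB' wB'] sigB'] := l_sig lyw w0 (s1Q _ (UU1 _ Uy)).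
  suff -> : B y = B' by [].
  by apply/matrixP => i j; rewrite mxE -vol_tensor_entry -wB'.
have sB : smooth_mx U B.
  move=> i j.
  have aw y : U y -> Defs.alternating (w y) by move=> /UU2/lw[].
  have := smooth_form2_eval oU aw sw' (subf _ _ UU1 (ss1 (delta_mx i 0)))
    (subf _ _ UU1 (ss1 (delta_mx j 1))).
  by apply: smooth_fun_congr => // y _; rewrite mxE.
(* The scale [e] is [1] or [-1]. *)
have [e [e0 eB]] : exists e : R, e != 0 /\ signature (e *: B x) p q.
  have [_ _ [sig|sig]] := BP _ Ux.
    by exists 1; rewrite oner_eq0 scale1r.
  exists (-1); rewrite oppr_eq0 oner_eq0; split=> //.
  exact: signature_scale_lt0 (ltrN10 _) sig.
have [S [d [uS Sd dp dq]]] := eB.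
have [K uK Kg] : exists2 K, K \in unitmx & K^T *m diag_mx d *m K = g.
  apply: signature_congruent pq _ g_sig.
  have uST : S^T \in unitmx by rewrite unitmx_tr.
  by have := signature_congr uST eB; rewrite trmxK Sd.
pose B1 y := S *m (e *: B y) *m S^T.
have sB1 : smooth_mx U B1.
  do 2?[apply: smooth_mxM => //]; try exact: smooth_mx_cst.
  by apply: smooth_mxZ => //; exact: smooth_fun_cst.
have symB1 y : U y -> (B1 y)^T = B1 y.
  move=> /BP[symB _ _]; rewrite /B1 !trmx_mul trmxK linearZ /= symB.
  by rewrite mulmxA.
have [U' [C [oU' U'x U'U sC Cd]]] :=
  smooth_sylvester (signature_neq0 pq dp dq) oU Ux sB1 symB1 Sd.
(* The change of basis of [F] which carries [s1] to an adapted frame. *)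
pose L y := S^T *m C y *m K.
have Lg y : U' y -> (L y)^T *m (e *: B y) *m L y = g.
  move=> U'y; rewrite -Kg -(Cd _ U'y) /L /B1 !trmx_mul !trmxK.
  by rewrite !mulmxA.
have sL : smooth_mx U' L.
  do 2?[apply: smooth_mxM => //]; exact: smooth_mx_cst.
exists U', (fun y X => s1 y (L y *m X)); split=> //.
- move=> y U'y; have Uy := U'U _ U'y; have Q1 := s1Q _ (UU1 _ Uy).
  have uL : L y \in unitmx.
    by move: g_unit; rewrite -(Lg _ U'y) unitmx_mul => /andP[].
  split.
    rewrite (Q_orbit Q1); exists (fun X => L y *m X *m invmx 1%:M).
      by exists 1%:M, (L y); rewrite unitmx1.
    by apply/funext => X; rewrite /= invmx1 mulmx1.
  have [_ _ lE] := lw _ (UU2 _ Uy); have [_ wB _] := BP _ Uy.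
  exists (rescale e (w y)); first by rewrite lE; exists e.
  apply/funext => X; apply/funext => Y.
  rewrite -(Lg _ U'y) -scalemxAr -scalemxAl vol_tensorZ; congr (_ * _).
  rewrite -[LHS]/(pullback (s1 y) (w y) (L y *m X) (L y *m Y)) wB.
  by rewrite -[L y *m X]mulmx1 -[L y *m Y]mulmx1 vol_tensor_mul det1 scale1r.
- move=> X.
  have U'U1 : U' `<=` U1 by move=> y /U'U/UU1.
  pose Y y : tangent y := \sum_(k : 'I_n * 'I_2)
    (L y *m X) k.1 k.2 *: s1 y (delta_mx k.1 k.2).
  have sY : smooth_vector_field U' Y.
    apply: (@smooth_field_comb _ _ _ _ oU' _ _ (fun k y => (L y *m X) k.1 k.2)
      (fun k y => s1 y (delta_mx k.1 k.2))).
      by move=> k; apply: smooth_mxM => //; exact: smooth_mx_cst.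
    by move=> k; exact: subf (ss1 _).
  move=> c ac; apply: smooth_congr (sY c ac); first exact: chart_img_open.
  move=> _ [y [U'y cy] <-]; rewrite chartK//; congr (tan_to c _).
  have [ls _] := Q_iso (s1Q _ (U'U1 _ U'y)).
  pose sL1 : {linear V -> tangent y} :=
    HB.pack (s1 y) (GRing.isLinear.Build _ _ _ _ (s1 y) ls).
  rewrite /Y [in RHS](matrix_sum_delta (L y *m X)) -[RHS]/(sL1 _).
  rewrite linear_sum -(pair_bigA _ (fun i j =>
    (L y *m X) i j *: s1 y (delta_mx i j))) /=.
  apply: eq_bigr => i _; rewrite -[RHS]/(sL1 _) linear_sum.
  by apply: eq_bigr => j _; rewrite -[RHS]/(sL1 _) linearZ.
Qed.

(** Since [l x] is a line, the forms which two adapted frames carry to the model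
    form are proportional; so the change of frame preserves the model line. *)
Lemma adapted_frames_pacs : PACS_structure g P.
Proof.
split=> [x u [Qu _]|x u [Qu [w lw uw]]|x]; first exact: Q_iso.
  have [_ bu] := Q_iso Qu.
  have [U [w1 [_ Ux _ /(_ _ Ux)[_ _ lE]]]] := l_acs.1 x.
  (* Any nonzero element of [l x] spans it. *)
  have lZ w2 w3 : l x w2 -> w2 <> @zero_form R _ -> l x w3 -> form_line w2 w3.
    rewrite lE => -[a ->] aw [b ->].
    have a0 : a != 0.
      apply/eqP => a0; apply: aw; rewrite a0.
      exact: (rescale0 (w1 x)).
    by rewrite (form_line_rescale _ a0); exists b.
  have lw0 : w <> @zero_form R _.
    by move=> w0; apply: g0; rewrite -uw w0.
  apply/seteqP; split=> [v [Qv [w' lw' vw']]|_ [h h0 <-]].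
    move: (Qv); rewrite (Q_orbit Qu) => -[h hH vE]; exists h => //; split=> //.
    have [b wb] := lZ _ _ lw lw0 lw'.
    apply: (@CSp_of_pullback _ _ _ _ b 1); rewrite ?oner_eq0//.
    by rewrite rescale1 -[RHS]vw' -vE wb -uw.
  split; first by rewrite (Q_orbit Qu); exists h => //; exact: h0.2.
  have [b b0 hb] := G0_pullback g0 h0.
  exists (rescale b^-1 w).
    by move: lw; rewrite lE => -[a ->]; exists (b^-1 * a);
      rewrite -[RHS]/(rescale _ _) -rescaleA.
  rewrite -[LHS]/(rescale b^-1 (pullback h (pullback u w))) uw hb rescaleA.
  by rewrite mulVf// rescale1.
exact: adapted_frames_section.
Qed.

Lemma induced_grassmannian_adapted : induced_grassmannian P = Q.
Proof.
apply/functional_extensionality_dep => x; apply/seteqP; split=> u.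
  by move=> [v [Qv _] [h hH <-]]; rewrite (Q_orbit Qv); exists h.
move=> Qu; have [U [s [_ Ux sP _]]] := adapted_frames_section x.
have Ps := sP _ Ux; have [Qs _] := Ps.
by move: Qu; rewrite (Q_orbit Qs) => -[h hH <-]; exists (s x) => //; exists h.
Qed.

Lemma induced_line_adapted : induced_line g P = l.
Proof.
apply/functional_extensionality_dep => x.
have [U [s [_ Ux sP _]]] := adapted_frames_section x.
have Ps := sP _ Ux; have [Qs [w lw sw]] := Ps; have [_ bs] := Q_iso Qs.
rewrite (induced_lineE adapted_frames_pacs Ps) -sw.
have [U2 [w1 [_ U2x _ /(_ _ U2x)[_ _ lE]]]] := l_acs.1 x.
have [a wE] : form_line (w1 x) w by rewrite -lE.
have a0 : a != 0.
  apply/eqP => a0; apply: g0; rewrite -sw wE a0.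
  by apply/funext => X; apply/funext => Y; rewrite /pullback mul0r.
have -> : l x = form_line w.
  by rewrite lE wE; rewrite (form_line_rescale _ a0).
apply/seteqP; split=> w' [b wb]; exists b; last by rewrite wb.
exact: (pullback_inj bs).
Qed.

End Reduced.
End Equivalence.

Theorem proposition3p4 (R : realType) (p q : nat) (pq_ge3 : (3 <= p + q)%N)
    (g : 'M[R]_(p + q)) (g_sym : g^T = g) (g_sig : signature g p q)
    (M : manifold R (2 * (p + q))) :
  set_bij
    [set P : forall x : M, set ('M[R]_(p + q, 2) -> tangent x) |
      PACS_structure g P]
    [set Ql : (forall x : M, set ('M[R]_(p + q, 2) -> tangent x)) *
              (forall x : M, set (form2 (tangent x))) |
      [/\ almost_grassmannian Ql.1,
          almost_conformally_symplectic Ql.2,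
          hermitian_line Ql.1 Ql.2 &
          line_signature Ql.1 Ql.2 p q]]
    (fun P => (induced_grassmannian P, induced_line g P)).
Proof.
have n_gt0 : (0 < p + q)%N by exact: leq_trans pq_ge3.
have g_unit := signature_unitmx erefl g_sig.
split=> [P P_pacs|P P' /set_mem P_pacs /set_mem P'_pacs [PQ Pl]|[Q l]].
- split=> /=.
  + exact: induced_almost_grassmannian P_pacs.
  + exact: induced_almost_conformally_symplectic.
  + exact: induced_hermitian.
  + exact: induced_signature.
- rewrite -(adapted_frames_induced g_unit n_gt0 P_pacs) PQ Pl.
  exact: adapted_frames_induced.
- move=> [/= Q_gr l_acs _ l_sig].
  exists (adapted_frames g Q l); first exact: adapted_frames_pacs l_sig.
  congr pair; first exact: induced_grassmannian_adapted l_sig.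
  exact: induced_line_adapted l_sig.
Qed.
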